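(* Let $I=\{1,\dots,n\}$. For each $i\in I$ let $X_i$ be a nonempty compact convex subset of a real Hausdorff locally convex space, let $X=\prod_{i\in I}X_i$, let $S_i,Q_i:X\to 2^{X_i}$ be set-valued maps with nonempty values, and let $\varphi_i:X\to\mathbf{R}$ be a function. Suppose that, for each $i\in I$: (H2) for any fixed $x_j\in X_j$, $j\neq i$, the set $\{z_i\in X_i\mid z_i\in S_i(x_1,\dots,x_{i-1},z_i,x_{i+1},\dots,x_n)\}$ is convex; (H4) for every net $(x^\alpha)_{\alpha\in A}$ in $X$, $x^\alpha=(x_1^\alpha,\dots,x_n^\alpha)$, with $x^\alpha\to x^0=(x_1^0,\dots,x_n^0)\in X$, if $x_i^\alpha\in S_i(x^\alpha)$ for every $\alpha\in A$, then $x_i^0\in S_i(x^0)$; (a) for any fixed $x_j\in X_j$, $j\neq i$, there exists $\bar x_i\in X_i$ such that $\bar x_i\in S_i(x_1,\dots,\bar x_i,\dots,x_n)$ and $\varphi_i(x_1,\dots,x_{i-1},\bar x_i,x_{i+1},\dots,x_n)\le\varphi_i(x_1,\dots,x_{i-1},y_i,x_{i+1},\dots,x_n)$ for all $y_i\in Q_i(x_1,\dots,\bar x_i,\dots,x_n)$; (b) for any fixed $x_j\in X_j$, $j\neq i$, the function $\varphi_i(x_1,\dots,x_{i-1},\cdot,x_{i+1},\dots,x_n)$ is quasiconvex on $X_i$, and $Q_i$ does not depend on the $i$-th variable; (c) $\varphi_i$ is continuous and $Q_i$ is lower semicontinuous. Then there exists $\bar x=(\bar x_1,\dots,\bar x_n)\in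 X$ such that for each $i\in I$, $\bar x_i\in S_i(\bar x)$ and $\varphi_i(\bar x_1,\dots,\bar x_n)\le\varphi_i(\bar x_1,\dots,\bar x_{i-1},y_i,\bar x_{i+1},\dots,\bar x_n)$ for all $y_i\in Q_i(\bar x)$.
   Context: $2^{X_i}$ denotes the set of all subsets of $X_i$; $X$ carries the product topology. When $x_j\in X_j$ are fixed for $j\neq i$ and $z\in X_i$, the notation $(x_1,\dots,z,\dots,x_n)$ means $(x_1,\dots,x_{i-1},z,x_{i+1},\dots,x_n)$, i.e. $z$ is in the $i$-th position. A set-valued mapping $T:U\to 2^V$ with nonempty values between topological spaces is lower semicontinuous if for every closed set $C\subset V$ the set $\{u\in U\mid T(u)\subset C\}$ is closed; for Hausdorff spaces $U,V$ this is equivalent to: for any $u\in U$, any net $(u_\alpha)_{\alpha\in A}$ converging to $u$ and every $v\in T(u)$, there exist $v_\alpha\in T(u_\alpha)$ such that the net $(v_\alpha)_{\alpha\in A}$ converges to $v$. *)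

(* Defs.v *)
From mathcomp Require Import all_boot all_order all_algebra.
From mathcomp Require Import all_classical all_reals all_analysis.
Import Order.TTheory GRing.Theory Num.Theory.
Import numFieldNormedType.Exports.

Set Implicit Arguments.
Unset Strict Implicit.
Unset Printing Implicit Defensive.

Local Open Scope classical_set_scope.
Local Open Scope ring_scope.
Local Open Scope convex_scope.

Definition directed (A : Type) (le : A -> A -> Prop) : Prop :=
  [/\ inhabited A,
      forall a, le a a,
      forall a b c, le a b -> le b c -> le a c &
      forall a b, exists c, le a c /\ le b c].

(* A net [u : A -> T] converges to [l] iff [u @ tails le --> l]. *)
Definition tails (A : Type) (le : A -> A -> Prop) : set_system A :=
  [set P | exists a, forall b, le a b -> P b].

Lemma tails_filter (A : Type) (le : A -> A -> Prop) :
  directed le -> ProperFilter (tails le).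
Proof.
move=> [[a0] le_refl le_trans le_ub]; apply: Build_ProperFilter_ex.
  by move=> P [a aP]; exists a; apply: aP.
split; first by exists a0.
- move=> P Q [a aP] [b bQ]; have [c [ac bc]] := le_ub a b.
  exists c => d cd; split; first exact/aP/(le_trans _ c).
  exact/bQ/(le_trans _ c).
- by move=> P Q PQ [a aP]; exists a => b /aP /PQ.
Qed.

(* The points [x] with [x i \in X i] for all [i]; the product topology on the
   product of the subspaces [X i] is the subspace topology of [prod_set X] in
   [prod_topology E]. *)
Definition prod_set (I : Type) (E : I -> Type) (X : forall i, set (E i)) :
    set (prod_topology E) :=
  [set x | forall i, X i (x i)].

(* A set-valued map from the subspace [D] of [U] to the subspace [B] of [V] is
   represented by a total [T : U -> set V] of which only the values on [D],
   assumed to be subsets of [B], matter.  Closedness is relative to [D] and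
   [B]. *)
Definition set_valued_lsc (U V : topologicalType) (D : set U) (B : set V)
    (T : U -> set V) : Prop :=
  forall C : set V, C `<=` B -> closed (C : set (subspace B)) ->
    closed ([set u | D u /\ T u `<=` C] : set (subspace D)).

Definition quasiconvex_on (R : realType) (E : lmodType R) (D : set E)
    (f : E -> R) : Prop :=
  forall (t : {i01 R}) (x y : convex_lmodType E), D x -> D y ->
    f (x <| t |> y) <= Num.max (f x) (f y).

(* Main.v *)
(* Put M i x = {z in X i | S i (x|z) z, phi i (x|z) <= phi i (x|y) for all y in
   Q i x}, where (x|z) is x with i-th coordinate z.  By (a), (H2) and (b) these
   sets are nonempty and convex; by (H4) and (c) the map M i has a closed
   graph.  A fixed point of x |-> prod_i M i x is the point we look for, so the
   theorem is an instance of the Kakutani-Fan-Glicksberg theorem.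

   The latter is obtained without Brouwer's theorem and without partitions of
   unity.  Scarf's lemma (a parity argument on sets that are dominant for
   finitely many linear orders) applied to finer and finer grids shows that, if
   sets G k cover the standard simplex, some point t of the simplex is in the
   closure of G k for every k with t k != 0.  Cover the compact set X by
   entourage balls around a_1, ..., a_m, choose y_k in M(a_k), and take for G k
   the weights t such that sum_j t_j y_j is in the k-th ball: this yields a
   point x = sum_k t_k y_k such that a_k is close to x whenever t_k != 0.  Let
   x0 be a cluster point of such x for smaller and smaller entourages.  For any
   convex open Z i containing M i x0, upper semicontinuity puts the y_k i, hence
   x i, in Z i; therefore x0 i is in the closed set M i x0. *)

Require Import Defs.
From mathcomp Require Import all_boot zify.

Set Implicit Arguments.
Unset Strict Implicit.
Unset Printing Implicit Defensive.

(** * Scarf's lemma *)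

(** By counting, [f] takes exactly one value twice on [s]; the removable points are the two that
    share it. *)
Lemma card_imset_setD1 (A B : finType) (f : A -> B) (s : {set A})
    (J : {set B}) : #|s| = #|J|.+1 -> f @: s = J ->
  #|[set x in s | f @: (s :\ x) == J]| = 2.
Proof.
move=> sJ fs.
have [x0 x0s [x1 x1s [fx ne]]] : exists2 x0, x0 \in s &
    exists2 x1, x1 \in s & f x0 = f x1 /\ x0 != x1.
  have /dinjectivePn[x0 x0s [x1]] : ~~ dinjectiveb f (mem s).
    apply/negP => /dinjectiveP/imset_injP; rewrite fs sJ.
    by rewrite eqn_leq ltnn andbF.
  by rewrite inE /= => /andP[ne x1s] fx; exists x0 => //; exists x1;
    rewrite ?fx // eq_sym.
have onto x y : x \in s -> y \in s -> f x = f y -> x != y -> f @: (s :\ x) = J.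
  move=> xs ys fxy nxy; apply/eqP;
    rewrite eqEsubset -{1}fs imsetS ?subsetDl //=.
  apply/subsetP => b; rewrite -fs => /imsetP[z zs ->].
  have [->|zx] := eqVneq z x; last by rewrite imset_f // !inE zx.
  by rewrite fxy imset_f // !inE eq_sym nxy.
have inj x y : x \in s -> y \in s -> f x = f y -> x != y ->
    {in s :\ x &, injective f}.
  move=> xs ys fxy nxy; apply/imset_injP; rewrite (onto _ _ xs ys) //.
  by move: sJ; rewrite (cardsD1 x) xs add1n => -[->].
rewrite -[RHS](_ : #|[set x0; x1]| = 2); last by rewrite cards2 ne.
congr #|pred_of_set _|; apply/setP => x; rewrite !inE.
have [->|xx0] /= := eqVneq x x0; first by rewrite x0s (onto _ _ x0s x1s) ?eqxx.
have [->|xx1] /= := eqVneq x x1;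
  first by rewrite x1s (onto _ _ x1s x0s) ?eqxx // eq_sym.
apply/negP => /andP[xs /eqP/setP/(_ (f x))]; rewrite -fs [RHS]imset_f //.
case/imsetP => z; rewrite !inE => /andP[zx zs] fxz.
have [zx0|zx0] := eqVneq z x0; last first.
  have := inj _ _ x0s x1s fx ne x z;
    rewrite !inE xx0 zx0 xs zs => /(_ isT isT fxz).
  by move=> xz; rewrite xz eqxx in zx.
have := inj _ _ x0s x1s fx ne x x1; rewrite !inE xx0 eq_sym ne xs x1s -fx -zx0.
by move=> /(_ isT isT fxz) xz; rewrite xz eqxx in xx1.
Qed.

(** * Extending a dominant set by one point *)

Section Dominance.
Variables (V I : finType) (r : I -> V -> nat).
Hypothesis r_inj : forall i, injective (r i).

(** Scarf's dominant sets. Those with [#|I|] elements are the rooms of the parity argument; removing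
    one element leaves a door. *)
Definition dominant (s : {set V}) :=
  [forall y, exists i, [forall x in s, r i y <= r i x]].

Lemma dominantP (s : {set V}) :
  reflect (forall y, exists i, forall x, x \in s -> r i y <= r i x)
    (dominant s).
Proof.
apply: (iffP forallP) => h y; first by have /existsP[i /forall_inP] := h y;
  exists i.
by have [i hi] := h y; apply/existsP; exists i; apply/forall_inP.
Qed.

Lemma dominantS (s s' : {set V}) : s' \subset s -> dominant s -> dominant s'.
Proof.
move=> /subsetP ss /dominantP h; apply/dominantP => y.
by have [i hi] := h y; exists i => x /ss /hi.
Qed.

Section Door.
Variables (s : {set V}) (m : I -> V).
Hypothesis m_in : forall i, m i \in s.
Hypothesis m_min : forall i x, x \in s -> r i (m i) <= r i x.
Hypothesis s_dom : dominant s.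

(** Dominance tested at a point of [s] itself makes that point lowest in some order. *)
Lemma imset_min : m @: setT = s.
Proof.
apply/setP => x; apply/imsetP/idP => [[i _ ->] //|xs].
have /dominantP/(_ x)[i hi] := s_dom; exists i => //.
by apply: (@r_inj i); apply/eqP; rewrite eqn_leq hi // m_min.
Qed.

(** Since [s] is dominant, such a point is at most [m l] in order [l]: joined to [s], it is lowest
    there and leaves the other minima unchanged. *)
Definition above (l : I) (y : V) :=
  [forall i, (i != l) ==> (r i (m i) < r i y)].

Lemma aboveP l y : reflect (forall i, i != l -> r i (m i) < r i y) (above l y).
Proof. by apply: (iffP forallP) => h i; have /implyP := h i. Qed.

(* If x |: s is dominant, x is lowest in x |: s for exactly one order l, and
   then x is the r l-largest element of [above l]. *)
Lemma card_rooms : #|s|.+1 = #|I| ->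
  #|[set x | x \notin s & dominant (x |: s)]| =
  #|[set l | (m @: (setT :\ l) == s) && [exists y, above l y]]|.
Proof.
move=> cs.
(* The default [m l] only occurs when [above l] is empty, which membership in [L] excludes. *)
pose g l := [arg max_(y > odflt (m l) [pick y | above l y] in above l) r l y].
have gP l : [exists y, above l y]
  -> above l (g l) /\ forall y, above l y -> r l y <= r l (g l).
  case/existsP => y ly; rewrite /g; case: pickP => [z lz|/(_ y)];
    last by rewrite ly.
  by case: arg_maxnP.
pose L := [set l | (m @: (setT :\ l) == s) && [exists y, above l y]].
rewrite -/L -(@card_in_imset _ _ g (mem L)); last first.
  (* A common value of [g] at two distinct orders would exceed the minima of [s] in every order. *)
  move=> l l'; rewrite !inE => /andP[_ /gP[gl _]] /andP[_ /gP[gl' _]] e.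
  apply/eqP/negPn/negP => ll'.
  have /dominantP/(_ (g l))[i /(_ (m i) (m_in i))] := s_dom;
    rewrite leqNgt => /negP; apply.
  have [->|il] := eqVneq i l; last exact: (aboveP _ _ gl).
  by rewrite e; apply: (aboveP _ _ gl').
congr #|pred_of_set _|; apply/setP => x; rewrite inE; apply/andP/imsetP.
- case=> xs /dominantP h; have [l hl] := h x.
  (* Dominance tested at [z] gives [i]; it differs from [l], where [x] is lowest, because [x] is not
     in [s]. *)
  have zm z : z \in s -> exists i, [/\ i != l, z = m i & r i z <= r i x].
    move=> zs; have [i hi] := h z; exists i.
    have zx : r i z <= r i x by rewrite hi // setU11.
    split=> //.
      apply/eqP => il; move: xs; suff -> : x = z by rewrite zs.
      apply: (@r_inj l); apply/eqP; rewrite eqn_leq hl ?setU1r //=.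
      by rewrite -il.
    by apply: (@r_inj i); apply/eqP; rewrite eqn_leq m_min // hi // setU1r.
  have ms : m @: (setT :\ l) = s.
    apply/setP => z; apply/imsetP/idP => [[i _ -> //]|/zm[i [il -> _]]].
    by exists i; rewrite // !inE il.
  have m_inj : {in setT :\ l &, injective m}.
    by apply/imset_injP; rewrite ms -eqSS cs -cardsT (cardsD1 l) inE add1n.
  have lx : above l x.
    apply/aboveP => i il; have [j [jl mij le]] := zm _ (m_in i).
    have ij : i = j by apply: m_inj; rewrite // !inE ?il ?jl.
    subst j; rewrite ltn_neqAle le andbT; apply: contra xs => /eqP/r_inj <-.
    exact: m_in.
  have Lx : [exists y, above l y] by apply/existsP; exists x.
  exists l; first by rewrite inE ms eqxx.
  have [gl gmax] := gP _ Lx; apply: (@r_inj l); apply/eqP;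
    rewrite eqn_leq gmax //=.
  have [i hi] := h (g l); have [il|il] := eqVneq i l;
    first by move: (hi x (setU11 x s)); rewrite il.
  by have := aboveP _ _ gl i il; rewrite ltnNge hi // setU1r.
- case=> l; rewrite inE => /andP[/eqP ms /gP[gl gmax]] ->; split.
    apply/negP; rewrite -ms => /imsetP[i]; rewrite !inE => /andP[il _] gm.
    by have := aboveP _ _ gl i il; rewrite gm ltnn.
  (* Order [l] serves the points of [above l]; any other [y] is at most some [m i] with [i != l],
     still lowest in the enlarged set. *)
  apply/dominantP => y; have [/gmax yg|/forallPn[i]] := boolP (above l y);
    last first.
    rewrite negb_imply => /andP[il]; rewrite -leqNgt => yi; exists i => z.
    rewrite !inE => /orP[/eqP->|zs]; last exact: leq_trans yi (m_min _ zs).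
    exact: leq_trans yi (ltnW (aboveP _ _ gl i il)).
  exists l => z; rewrite !inE => /orP[/eqP-> //|zs].
  apply: leq_trans yg _; have /dominantP/(_ (g l))[i hi] := s_dom.
  have [il|il] := eqVneq i l; first by move: (hi z zs); rewrite il.
  by have := aboveP _ _ gl i il; rewrite ltnNge hi.
Qed.

Lemma card_rooms2 : #|s|.+1 = #|I| ->
    (forall l, m @: (setT :\ l) = s -> exists y, above l y) ->
  #|[set x | x \notin s & dominant (x |: s)]| = 2.
Proof.
move=> cs h; rewrite card_rooms // -(@card_imset_setD1 _ _ m setT s) ?imset_min
  ?cardsT //.
apply: eq_card => l; rewrite !inE /=; case: eqP => //= /h[y ly].
by apply/existsP; exists y.
Qed.

End Door.
End Dominance.

(** * Parity argument over rooms and doors *)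

Section Scarf.
Variables (V I : finType) (r : I -> V -> nat) (e : I -> V) (c : V -> I).
Variable y0 : V.
Hypothesis r_inj : forall i, injective (r i).
Hypothesis e_min : forall i y, r i (e i) <= r i y.
Hypothesis e_max : forall i j y, i != j -> y \notin codom e ->
  r i y < r i (e j).
Hypothesis c_e : cancel e c.
Hypothesis y0_notin : y0 \notin codom e.

Lemma exists_min (s : {set V}) : s != set0 ->
  exists m : I -> V,
    forall i, m i \in s /\ forall x, x \in s -> r i (m i) <= r i x.
Proof.
case/set0Pn => x0 x0s; exists (fun i => [arg min_(x < x0 in s) r i x]) => i.
by case: arg_minnP.
Qed.

(** The slack point [e l] belongs to [above l] unless some minimum [m i] is an [e j] with [j != i].
    In that case [s] consists of all slack points but [e i], and the colours force [i = i0]. *)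
Lemma door_to_rooms (i0 : I) (s : {set V}) : s != set0 -> dominant r s ->
  #|s|.+1 = #|I| -> c @: s = setT :\ i0 -> s != e @: (setT :\ i0) ->
  #|[set x | x \notin s & dominant r (x |: s)]| = 2.
Proof.
move=> /exists_min[m mP] s_dom cs cls ns.
have m_in i : m i \in s by have [] := mP i.
have m_min i x : x \in s -> r i (m i) <= r i x by have [_] := mP i; apply.
apply: (card_rooms2 r_inj m_in m_min s_dom cs) => l ms.
have star i j : i != j -> m i <> e j.
  move=> ij mi; case/eqP: ns.
  have sub : s \subset e @: (setT :\ i).
    apply/subsetP => x xs; have /codomP[k xk] : x \in codom e.
      by apply: contraTT (m_min i x xs) => xe; rewrite -ltnNge mi e_max.
    rewrite xk imset_f // !inE andbT; apply: contraTneq (m_min i x xs) => ki.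
    rewrite xk ki mi -ltnNge ltn_neqAle e_min andbT.
    by apply/eqP => /r_inj/(can_inj c_e) eij; rewrite eij eqxx in ij.
  have se : s = e @: (setT :\ i).
    apply/eqP; rewrite eqEcard sub /= card_imset; last exact: can_inj c_e.
    by rewrite -ltnS cs -cardsT [X in _ < X](cardsD1 i) inE.
  move: cls; rewrite se -imset_comp (eq_imset _ c_e) imset_id => ei.
  by rewrite ei.
exists (e l); apply/aboveP => i il.
have [me|me] := boolP (m i \in codom e); last exact: e_max.
have [j mj] := codomP me; have [ji|ji] := eqVneq i j;
  last by case: (star _ _ ji mj).
rewrite mj -ji ltn_neqAle e_min andbT; apply/eqP => /r_inj/(can_inj c_e) eil.
by rewrite eil eqxx in il.
Qed.

Lemma outer_dominant (i0 : I) : dominant r (e @: (setT :\ i0)).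
Proof.
apply/dominantP => y; have [/codomP[i ->]|ye] := boolP (y \in codom e).
  by exists i.
exists i0 => _ /imsetP[j + ->]; rewrite !inE andbT eq_sym => ji.
exact/ltnW/e_max.
Qed.

Lemma outer_to_room (i0 : I) : 1 < #|I| ->
  let s := e @: (setT :\ i0) in
  #|[set x | x \notin s & dominant r (x |: s)]| = 1.
Proof.
move=> I2 s; have e_inj := can_inj c_e.
have cs : #|s|.+1 = #|I|.
  by rewrite card_imset // -cardsT [RHS](cardsD1 i0) inE.
have /exists_min[m mP] : s != set0 by rewrite -cards_eq0 -lt0n -ltnS cs.
have m_in i : m i \in s by have [] := mP i.
have m_min i x : x \in s -> r i (m i) <= r i x by have [_] := mP i; apply.
rewrite (card_rooms r_inj m_in m_min (outer_dominant i0) cs) -[RHS](cards1 i0).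
have es i : i != i0 -> e i \in s by move=> ii0; rewrite imset_f // !inE ii0.
have mi i : i != i0 -> m i = e i.
  by move=> ii0; apply: (@r_inj i); apply/eqP; rewrite eqn_leq m_min ?es ?e_min.
congr #|pred_of_set _|; apply/setP => l; rewrite !inE.
have [->|ll0] := eqVneq l i0.
  apply/andP; split.
    apply/eqP/eq_in_imset => i; rewrite !inE andbT; exact: mi.
  apply/existsP; exists y0; apply/aboveP => i ii0; rewrite mi //.
  rewrite ltn_neqAle e_min andbT; apply: contra y0_notin => /eqP/r_inj <-.
  exact: codom_f.
apply/negP => /andP[/eqP ml /existsP[y /aboveP yl]].
have [j + mj] := imsetP (m_in i0); rewrite !inE andbT => ji0.
have l0l : i0 != l by rewrite eq_sym.
have := yl i0 l0l; rewrite mj => yj.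
have /codomP[k yk] : y \in codom e.
  by apply: contraLR yj => ye; rewrite -leqNgt ltnW // e_max // eq_sym.
have kl : k = l.
  apply/eqP/negPn/negP => kl; have := yl k kl; rewrite yk ltnNge => /negP;
    apply.
  have [->|ki0] := eqVneq k i0; last by rewrite mi.
  by move: yj; rewrite yk; have [->|ki0'] := eqVneq k i0;
    rewrite // ltnNge e_min.
subst k; have : e l \in m @: (setT :\ l) by rewrite ml es.
case/imsetP => i; rewrite !inE andbT => il eli.
have [ii0|ii0] := eqVneq i i0; last first.
  by move: eli; rewrite mi // => /e_inj eil; rewrite eil eqxx in il.
by move: (yl i0 l0l); rewrite -ii0 -eli yk ltnn.
Qed.

(** Double counting of the pairs of a room and a point whose removal leaves a door. *)
Lemma sum_rooms_doors (J : {set I}) :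
  \sum_(s : {set V} | dominant r s && (#|s| == #|J|.+1))
     #|[set x in s | c @: (s :\ x) == J]| =
  \sum_(s : {set V} | (c @: s == J) && (#|s| == #|J|))
     #|[set x | x \notin s & dominant r (x |: s)]|.
Proof.
under eq_bigr do rewrite -sum1dep_card.
under [RHS]eq_bigr do rewrite -sum1dep_card.
rewrite (exchange_big_dep xpredT) //= [RHS](exchange_big_dep xpredT) //=.
apply: eq_bigr => x _.
rewrite (reindex_onto (fun s => x |: s) (fun s => s :\ x)) /=; last first.
  by move=> s /andP[_ /andP[xs _]]; rewrite setD1K.
apply: eq_bigl => s; rewrite setU11 /=.
have [xs|xs] := boolP (x \in s).
  rewrite andbF; apply/negbTE; rewrite negb_and orbC; apply/orP; left.
  by apply/eqP => /setP/(_ x); rewrite !inE eqxx xs.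
by rewrite setU1K // eqxx cardsU1 xs add1n eqSS; do !case: (_ == _);
  case: (dominant _ _).
Qed.

(* Parity of the incidences between dominant sets with #|I| elements and their
   subsets s with c @: s = setT :\ i0: each of these subsets is contained in two
   such dominant sets, except e @: (setT :\ i0), which is contained in one. *)
Theorem scarf : exists2 s : {set V}, dominant r s & c @: s = setT.
Proof.
have [i0 _] : exists i : I, true by exists (c y0).
(* With a single order doors would be empty; the highest point alone is a suitable room. *)
have [I1|I2] := leqP #|I| 1.
  have c0 (i : I) : i = i0 by apply: (fintype_le1P I1).
  exists [set [arg max_(y > y0) r i0 y]].
    apply/dominantP => y; exists i0 => x /set1P->;
      by case: arg_maxnP => // z _; apply.
  by apply/setP => i; rewrite imset_set1 !inE [i]c0 [X in _ == X]c0 eqxx.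
pose J := setT :\ i0.
have cJ : #|J|.+1 = #|I| by rewrite -cardsT [RHS](cardsD1 i0) inE.
have [/existsP[s /andP[? /eqP ?]]|/existsPn noroom] :=
  boolP [exists s, dominant r s && (c @: s == setT)]; first by exists s.
have /(congr1 odd) := sum_rooms_doors J.
rewrite (@big_morph _ _ odd false addb 0 addn oddD erefl) big1; last first.
  move=> s /andP[s_dom /eqP cs].
  have [->|] := set_0Vmem [set x in s | c @: (s :\ x) == J];
    first by rewrite cards0.
  case=> x; rewrite inE => /andP[xs /eqP cx].
  (* The colours of a room with such a door are [J] or everything; the latter is excluded, so the
     room has exactly two doors. *)
  have cJs : c @: s = J.
    have Js : J \subset c @: s by rewrite -cx imsetS // subsetDl.
    apply/eqP; rewrite eqEsubset Js andbT; apply: contraR (noroom s) => cs'.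
    rewrite s_dom eqEsubset subsetT /=; apply/subsetP => i _.
    have [->|ii0] := eqVneq i i0; last by apply: (subsetP Js); rewrite !inE ii0.
    have [k ks] := subsetPn cs'; rewrite !inE andbT negbK => /eqP <-; exact: ks.
  by rewrite (card_imset_setD1 cs cJs).
pose o := e @: J.
have co : (c @: o == J) && (#|o| == #|J|).
  rewrite /o -imset_comp (eq_imset _ c_e) imset_id eqxx card_imset ?eqxx //.
  exact: can_inj c_e.
rewrite (bigD1 o) //= outer_to_room // oddD /= (@big_morph _ _ odd false addb 0
  addn oddD erefl).
rewrite big1 // => s /andP[/andP[/eqP cs /eqP sJ] so].
have s0 : s != set0 by rewrite -cards_eq0 -lt0n -ltnS sJ cJ.
have [s_dom|s_dom] := boolP (dominant r s); last first.
  rewrite (_ : [set x | _] = set0) ?cards0 //; apply/setP => x; rewrite !inE.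
  apply: contraNF s_dom => /andP[_]; exact/dominantS/subsetUr.
by rewrite (@door_to_rooms i0) // sJ.
Qed.

End Scarf.

(** * Scarf's lemma on the grid of a simplex *)

Section Grid.
Variables (I : finType) (i0 : I) (N : nat) (c : (I -> nat) -> I).

Let T : finType := {t : {ffun I -> 'I_N.+1} | \sum_i (t i : nat) == N}.
Let crd (t : T) : I -> nat := fun i => val t i.

Let crd_sum (t : T) : \sum_i crd t i = N.
Proof. exact/eqP/(valP t). Qed.

Let crd_onto (f : I -> nat) : \sum_i f i = N -> exists t : T, crd t =1 f.
Proof.
move=> fN; have fi i : f i < N.+1 by rewrite ltnS -fN (bigD1 i) //= leq_addr.
have sN : \sum_i (([ffun i => inord (f i)] : {ffun I -> 'I_N.+1}) i : nat) == N.
  by apply/eqP; rewrite -[RHS]fN; apply: eq_bigr => i _; rewrite ffunE inordK.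
by exists (Sub (sT := T) _ sN) => i; rewrite /crd /= ffunE inordK.
Qed.

(* Order i compares the i-th coordinates of grid points, ties being broken by
   enum_rank.  The slack point inr i is the lowest one in order i, and is above
   all grid points in the other orders; slack points spare us the pairs (set of
   points, set of colours) of the usual formulation of Scarf's lemma. *)
Let rk (i : I) (v : T + I) : nat :=
  match v with
  | inl t => (crd t i * #|T| + enum_rank t).+1
  | inr j => if j == i then 0 else (N.+1 * #|T| + enum_rank j).+1
  end.

Let rk_inl i t : rk i (inl t) = (crd t i * #|T| + enum_rank t).+1.
Proof. by []. Qed.

Let crd_leN t i : crd t i <= N. Proof. by rewrite -ltnS ltn_ord. Qed.

Let rk_lt (t : T) i : rk i (inl t) < (N.+1 * #|T|).+1.
Proof.
rewrite /= ltnS mulSn addnC -addSn leq_add ?ltn_ord //.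
by rewrite leq_mul2r crd_leN orbT.
Qed.

Let rk_inj i : injective (rk i).
Proof.
move=> [t|j] [t'|j'] /=.
- case=> /(congr1 (modn^~ #|T|)); rewrite !modnMDl !modn_small ?ltn_ord //.
  by move/val_inj/enum_rank_inj->.
- case: eqP => // _ e; have := rk_lt t i; rewrite /= e; lia.
- case: eqP => // _ e; have := rk_lt t' i; rewrite /= -e; lia.
- case: eqP => [->|ji]; case: eqP =>
  [->|ji'] // [] /addnI/val_inj/enum_rank_inj-> //.
Qed.

(** [C] collects the colours whose slack point is missing from the dominant set, so that a grid
    point [s i] must carry them. Dominance bounds from below the sum of the minima over [C], which
    leaves the chosen points little room to differ. *)
Lemma grid_labels : exists (C : {set I}) (s : I -> I -> nat),
  [/\ exists j, j \in C, forall i, i \in C -> c (s i) = i,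
    forall i, i \in C -> \sum_k s i k = N,
    forall i j k, i \in C -> j \in C -> s i k <= s j k + #|I| &
    forall i k, i \in C -> k \notin C -> s i k <= #|I|].
Proof.
have [t0 _] : exists t : T, crd t =1 (fun i => (i == i0) * N).
  apply: crd_onto; rewrite (bigD1 i0) //= eqxx mul1n big1 ?addn0 // => i.
  by move/negbTE->.
pose c' (v : T + I) := match v with inl t => c (crd t) | inr i => i end.
have noti t : inl t \notin codom (@inr T I).
  by apply/negP => /codomP[].
have [] := @scarf (T + I)%type I rk inr c' (inl t0) rk_inj.
- by move=> i y; rewrite /= eqxx.
- move=> i j [t|k]; last by rewrite codom_f.
  move=> ij _; rewrite [X in _ < X]/= eq_sym (negbTE ij).
  by rewrite (leq_trans (rk_lt t i)) // ltnS leq_addr.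
- by [].
- exact: noti.
move=> A /dominantP A_dom cA.
pose C := [set i | inr i \notin A].
(* An order whose slack point lies in [A] cannot be the witness: that point has rank 0 there, below
   every grid point. *)
have A_dom' t : exists2 i, i \in C &
    forall t', inl t' \in A -> crd t i <= crd t' i.
  have [i hi] := A_dom (inl t); exists i.
    by rewrite inE; apply/negP => /hi; rewrite /= eqxx.
  move=> t' /hi; rewrite !rk_inl ltnS leqNgt => h; rewrite leqNgt;
    apply: contra h => tt.
  have : enum_rank t' < #|T| by [];
    have : (crd t' i).+1 * #|T| <= crd t i * #|T|.
    by rewrite leq_mul2r tt orbT.
  by rewrite mulSn; lia.
have [s sP] : exists s : I -> T, forall i,
    i \in C -> inl (s i) \in A /\ c (crd (s i)) = i.
  apply: (fin_all_exists (P := fun i t =>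
    i \in C -> inl t \in A /\ c (crd t) = i)) => i.
  have : i \in c' @: A by rewrite cA.
  case/imsetP => -[t|j] xA ->; first by exists t.
  by exists t0; rewrite inE xA.
have [j0 j0C _] := A_dom' t0.
have [s0A _] := sP _ j0C.
have [m mP] : exists m : I -> T, forall i, inl (m i) \in A /\
    forall t, inl t \in A -> crd (m i) i <= crd t i.
  exists (fun i => [arg min_(t < s j0 | inl t \in A) crd t i]) => i.
  by case: arg_minnP.
(* Otherwise some grid point exceeds every minimum over [C], against dominance; the surplus [N - M]
   is put on coordinate [j0], in [C]. *)
have sum_m : N < \sum_(i in C) (crd (m i) i).+1.
  rewrite ltnNge; apply/negP => le.
  set M := \sum_(i in C) _ in le.
  have [t tP] : exists t, crd t =1
      (fun k => (k \in C) * (crd (m k) k).+1 + (k == j0) * (N - M)).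
    apply: crd_onto; rewrite big_split /= [X in _ + X](bigD1 j0) //= eqxx.
    rewrite [X in _ + (_ + X)]big1 => [|i /negbTE-> //].
    rewrite mul1n addn0 -[RHS](subnKC le); congr addn;
      rewrite /M [RHS]big_mkcond /=.
    by apply: eq_bigr => i _; case: (i \in C); rewrite ?mul1n.
  have [i iC /(_ (m i))] := A_dom' t.
  by rewrite tP iC mul1n; case: (mP i) => -> _ /(_ isT); lia.
(* The minima over [C] add up to more than [N - #|C|], so less than [#|C|] of the total [N]
   remains. *)
have sumC t : inl t \in A ->
    \sum_(i in C) (crd t i - crd (m i) i) +
    \sum_(i | i \notin C) crd t i < #|I|.
  move=> tA;
  have tN : \sum_(i in C) crd t i + \sum_(i | i \notin C) crd t i = N.
    by rewrite -(crd_sum t) [RHS](bigID (mem C)).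
  have split : \sum_(i in C) crd t i =
      \sum_(i in C) (crd t i - crd (m i) i) + \sum_(i in C) crd (m i) i.
    rewrite -big_split /=; apply: eq_bigr => i _.
    by rewrite subnK //; case: (mP i) => _; apply.
  have : \sum_(i in C) (crd (m i) i).+1 = \sum_(i in C) crd (m i) i + #|C|.
    by rewrite -sum1_card -big_split /=; apply: eq_bigr => i _; rewrite addn1.
  have : #|C| <= #|I| by exact: max_card.
  lia.
have inC t k : inl t \in A -> k \in C -> crd t k <= crd (m k) k + #|I|.
  by move=> /sumC + kC; rewrite (bigD1 k) //=; lia.
have outC t k : inl t \in A -> k \notin C -> crd t k <= #|I|.
  by move=> /sumC + kC; rewrite [X in _ + X](bigD1 k) //=; lia.
exists C, (fun i => crd (s i)); split.
- by exists j0.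
- by move=> i /sP[].
- by move=> i _; exact: crd_sum.
- move=> i j k /sP[iA _] /sP[jA _]; have [kC|kC] := boolP (k \in C).
    apply: leq_trans (inC _ _ iA kC) _; rewrite leq_add2r.
    by case: (mP k) => _; apply.
  by apply: leq_trans (outC _ _ iA kC) _; rewrite leq_addl.
- by move=> i k /sP[iA _]; exact: outC.
Qed.

End Grid.

From mathcomp Require Import all_boot all_order all_algebra.
From mathcomp Require Import all_classical all_reals all_analysis.
From mathcomp Require Import lra.
Import Order.TTheory GRing.Theory Num.Theory.
Import numFieldNormedType.Exports.

Local Open Scope classical_set_scope.
Local Open Scope ring_scope.

(** * Covers of the simplex *)

Definition simplex (R : realType) (m : nat) : set 'rV[R]_m :=
  [set t | (forall k, 0 <= t ord0 k) /\ \sum_k t ord0 k = 1].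

Section SimplexCover.
Variables (R : realType) (m : nat) (i0 : 'I_m).
Local Notation Delta := (@simplex R m).

Lemma compact_simplex : compact Delta.
Proof.
have cc k : continuous (fun t : 'rV[R]_m =>
  t ord0 k) by exact: coord_continuous.
apply: (@subclosed_compact _ _
  [set t : 'rV[R]_m | forall k, `[0, 1]%classic (t ord0 k)]).
- rewrite (_ : Delta = (\bigcap_k [set t : 'rV[R]_m | 0 <= t ord0 k]) `&`
      [set t : 'rV[R]_m | \sum_k t ord0 k = 1]).
    apply: closedI; first apply: closed_bigI => k _.
      by apply: (@closed_comp _ _ (fun t : 'rV[R]_m =>
        t ord0 k) [set x | 0 <= x]);
        [move=> t _; exact: cc|exact: closed_ge].
    apply: (@closed_comp _ _ (fun t : 'rV[R]_m =>
      \sum_k t ord0 k) [set x | x = 1]);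
      last exact: closed_eq.
    move=> t _; apply: continuous_big => [|k _]; last exact: cc.
    exact: (@add_continuous R^o).
  by rewrite eqEsubset; split=> t [h1 h2]; split=> // k; [move=> _|]; exact: h1.
- by apply: (@rV_compact R m (fun=> `[0, 1]%classic)) => k;
  exact: segment_compact.
- move=> t [t0 t1] k; rewrite /= in_itv /= t0 -t1 (bigD1 k) //= lerDl.
  by apply: sumr_ge0 => j _.
Qed.

Variable G : 'I_m -> set 'rV[R]_m.
Hypothesis G_cover : Delta `<=` \bigcup_k G k.

(** Each grid point of mesh [1 / N.+1] is coloured by the index of a set of the cover containing
    it. *)
Lemma grid_approx (N : nat) : exists2 q : 'rV[R]_m, Delta q &
  forall k, (exists q', [/\ Delta q', G k q' &
               forall j, `|q ord0 j - q' ord0 j| <= m%:R / N.+1%:R]) \/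
            q ord0 k <= m%:R / N.+1%:R.
Proof.
have /choice[c cP] t : exists k, Delta t -> G k t.
  by have [/G_cover[k _ Gk]|nt] := pselect (Delta t); [exists k|exists i0].
pose pt (u : 'I_m -> nat) : 'rV[R]_m := \row_k ((u k)%:R / N.+1%:R).
have N0 : 0 < N.+1%:R :> R by [].
have ptD u : (\sum_k u k = N.+1)%N -> Delta (pt u).
  move=> uN; split=> [k|]; first by rewrite mxE divr_ge0.
  under eq_bigr do rewrite mxE.
  by rewrite -mulr_suml -natr_sum uN divff ?gt_eqF.
have [C [s [[j0 j0C] cs sN sd sC]]] := @grid_labels 'I_m i0 N.+1 (c \o pt).
rewrite card_ord in sd sC.
exists (pt (s j0)); first exact/ptD/sN.
move=> k; have [kC|kC] := boolP (k \in C); [left|right].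
  exists (pt (s k)); split; [exact/ptD/sN| |move=> j].
    by rewrite -[in G k](cs _ kC); apply/cP/ptD/sN.
  rewrite !mxE -mulrBl normrM [X in _ * X]ger0_norm ?invr_ge0 // ler_pM2r
    ?invr_gt0 //.
  have := sd _ _ j j0C kC; have := sd _ _ j kC j0C.
  rewrite -!(ler_nat R) !natrD ler_norml => h1 h2; apply/andP; split; lra.
by rewrite mxE ler_pM2r ?invr_gt0 // ler_nat sC.
Qed.

(* KKM in dual form: no boundary condition on the cover is needed. *)
Lemma simplex_cover : exists2 t, Delta t &
  forall k, t ord0 k != 0 -> closure (Delta `&` G k) t.
Proof.
have /choice[q qP] (N : nat) : exists q : 'rV[R]_m, Delta q /\
  forall k, (exists q', [/\ Delta q', G k q' &
               forall j, `|q ord0 j - q' ord0 j| <= m%:R / N.+1%:R]) \/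
            q ord0 k <= m%:R / N.+1%:R.
  by have [q] := grid_approx N; exists q.
have qD : (q @ \oo) Delta by exists 0%N => // N _; exact: (qP N).1.
have [t [Dt clt]] := @compact_simplex (q @ \oo) _ qD.
exists t => // k tk; apply: contrapT => nclt.
have [e e0 eG] : exists2 e : R, 0 < e & forall y, ball t e y -> ~ (Delta `&` G
  k) y.
  have : nbhs t (~` (Delta `&` G k)).
    apply: contrapT => h; apply: nclt => B tB; apply: contrapT => hB; apply: h.
    by apply: filterS tB => y By yG; apply: hB; exists y.
  by move/nbhs_ballP => [e e0 he]; exists e.
(* [e / 2] serves when [q N] is near a point of [G k], and [t ord0 k / 2] when its [k]-th coordinate
   is small; both cases are contradictory. *)
pose d := Num.min (e / 2) (t ord0 k / 2).
have tk0 : 0 < t ord0 k by rewrite lt_neqAle eq_sym tk; case: Dt => ->.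
have d0 : 0 < d by rewrite lt_min !divr_gt0.
have m0 : 0 < m%:R :> R by rewrite ltr0n (leq_ltn_trans (leq0n i0)).
have dm0 : 0 < d / m%:R by rewrite divr_gt0.
have nearN : (q @ \oo) [set y | exists2 N, y = q N & m%:R / N.+1%:R < d].
  have := near_infty_natSinv_lt (PosNum dm0); apply: filterS => N /= hN.
  by exists N => //; rewrite mulrC -ltr_pdivlMr.
have [_ [[N -> Nd] [_ qt]]] := clt _ _ nearN (nbhsx_ballx t d d0).
have [_ /(_ k)[[q' [Dq' Gq' qq']]|qk]] := qP N.
  apply: (eG q') => //; split=> // i j; have -> : i = ord0 := ord1 i.
  rewrite /ball /= -(subrKA (q N ord0 j)).
  have := qt ord0 j; rewrite /ball /= => qtj.
  have dd : d <= e / 2 by rewrite ge_min lexx.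
  apply: le_lt_trans (ler_normD _ _) _.
  by apply: lt_le_trans (ltrD qtj (le_lt_trans (qq' j) Nd)) _; lra.
have := qt ord0 k; rewrite /ball /= => qtk.
have dd : d <= t ord0 k / 2 by rewrite ge_min lexx orbT.
have h : t ord0 k - q N ord0 k < d by exact: le_lt_trans (ler_norm _) qtk.
have h' : q N ord0 k < d by exact: le_lt_trans qk Nd.
clear -h h' dd; lra.
Qed.

End SimplexCover.

(** * Fixed points in products of locally convex spaces *)

Lemma convex_setP (R : numDomainType) (M : lmodType R) (A : set M) :
  convex_set A <-> forall (x y : M) (a : R), 0 <= a -> a <= 1 -> A x -> A y ->
    A (a *: x + (1 - a) *: y).
Proof.
split=> cA x y l.
  move=> l0 l1 /mem_set Ax /mem_set Ay; apply/set_mem.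
  have l01 : Itv.spec (@Itv.num_sem R) (Itv.Real `[0%Z, 1%Z]) l.
    by rewrite /= /Itv.num_sem/= realE l0 /= in_itv /= l0 l1.
  exact: (cA x y (Itv.mk l01) Ax Ay).
by move=> /set_mem Ax /set_mem Ay; apply/mem_set/cA.
Qed.

(** Induction on partial sums divided by their total weight; a zero weight of the head or of the
    tail is treated apart. *)
Lemma convex_sum (R : realFieldType) (M : lmodType R) (A : set M) (m : nat)
    (t : 'I_m -> R) (y : 'I_m -> M) :
  convex_set A -> (forall k, 0 <= t k) -> \sum_k t k = 1 ->
  (forall k, t k != 0 -> A (y k)) -> A (\sum_k t k *: y k).
Proof.
move=> /convex_setP cA t0 t1 Ay.
suff h (s : seq 'I_m) : 0 < \sum_(k <- s) t k ->
    A ((\sum_(k <- s) t k)^-1 *: \sum_(k <- s) t k *: y k).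
  by have := h (index_enum _); rewrite t1 invr1 scale1r; apply.
elim: s => [|k s IH]; first by rewrite big_nil ltxx.
rewrite !big_cons; set w := \sum_(_ <- _) _ in IH *; move=> tw0.
have w0 : 0 <= w by exact: sumr_ge0.
have [tk0|tk0] := eqVneq (t k) 0.
  by rewrite tk0 scale0r !add0r; apply: IH; move: tw0; rewrite tk0 add0r.
have [w00|w00] := eqVneq w 0.
  rewrite w00 addr0 [X in _ + X]big1_seq ?addr0 => [|j /= js].
    by rewrite scalerA mulVf // scale1r; exact: Ay.
  move: w00; rewrite /w => /eqP; rewrite psumr_eq0 // =>
    /allP/(_ _ js) /= /eqP ->.
  by rewrite scale0r.
have wp : 0 < w by rewrite lt_neqAle eq_sym w00.
have twn : t k + w != 0 by rewrite gt_eqF.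
have l0 : 0 <= t k / (t k + w) by rewrite divr_ge0 // addr_ge0.
have l1 : t k / (t k + w) <= 1 by rewrite ler_pdivrMr // mul1r lerDl.
have := cA _ _ _ l0 l1 (Ay _ tk0) (IH wp).
rewrite scalerDr !scalerA.
rewrite (_ : (1 - t k / (t k + w)) / w = (t k + w)^-1); first by rewrite mulrC.
have -> : 1 - t k / (t k + w) = w / (t k + w).
  by rewrite -{1}(divff twn) -mulrBl addrC addKr.
by rewrite mulrAC divff ?mul1r.
Qed.

(** * Product topology and total boundedness *)

Section ProductTopology.
Variables (I : eqType) (K : I -> topologicalType).

Lemma prod_cvg (T : Type) (F : set_system T) (f : T -> prod_topology K)
    (g : prod_topology K) : Filter F ->
  (forall i, (fun x => f x i) @ F --> g i) -> f @ F --> g.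
Proof.
move=> FF fg; apply/cvg_sup => i U [V] [[W oW <-] Wgi] WU.
by apply: filterS WU _; apply: fg; exact: open_nbhs_nbhs.
Qed.

Lemma dfwith_cvg (i : I) (x : prod_topology K) (z : K i) :
  (fun p : prod_topology K * K i =>
    dfwith p.1 i p.2) @ (x, z) --> (dfwith x i z : prod_topology K).
Proof.
apply: prod_cvg => j; have [<-|ij] := eqVneq i j.
  rewrite dfwithin (_ : (fun p => _) = snd); first exact: cvg_snd.
  by apply/funext => p; rewrite dfwithin.
rewrite dfwithout // (_ : (fun p => _) = @proj I K j \o fst); last first.
  by apply/funext => p; rewrite /= dfwithout.
apply: (@cvg_comp _ _ _ fst (@proj I K j) _ (nbhs x)); first exact: cvg_fst.
exact: proj_continuous.
Qed.

End ProductTopology.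

(** Compactness is used along the filter of finite lists ordered by inclusion: near [x], every list
    containing [x] will do. *)
Lemma compact_totally_bounded (U : uniformType) (A : set U) (D : set (U * U)) :
  compact A -> entourage D ->
  exists s : seq U, (forall a, a \in s -> A a) /\
    forall x, A x -> exists2 a, a \in s & D (a, x).
Proof.
move=> /compact_near_coveringP/near_covering_withinP cA eD.
pose F := filter_from [set: seq U] (fun s =>
  [set s' : seq U | {subset s <= s'}]).
have FF : Filter F.
  apply: filter_from_filter; first by exists [::].
  move=> s s' _ _; exists (s ++ s') => // u us; split=> a as_.
    by apply: us; rewrite mem_cat as_.
  by apply: us; rewrite mem_cat as_ orbT.
have := cA _ F (fun s x => exists2 a, a \in s /\ A a & D (a, x)) FF.
case=> [x Ax|s _ /(_ s (fun _ h => h)) sA].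
  exists (xsection D x, [set s | x \in s]); first split => /=.
  - exact: nbhs_entourage.
  - by exists [:: x] => // s /(_ x); rewrite /= mem_head; apply.
  - by case=> x' s [/= /xsectionP Dx xs] _; exists x.
exists [seq a <- s | `[< A a >]]; split=> [a|x /sA[a [as_ Aa] Da]].
  by rewrite mem_filter => /andP[/asboolP].
by exists a => //; rewrite mem_filter as_ andbT; exact/asboolP.
Qed.

Lemma continuous_comb (R : realType) (E : tvsType R) (m : nat) (y : 'I_m -> E) :
  continuous (fun t : 'rV[R]_m => \sum_k t ord0 k *: y k).
Proof.
move=> t; apply: continuous_big => [|k _]; first exact: add_continuous.
move=> {}t; apply: (@continuous_comp _ (R^o * E)%type _
  (fun t : 'rV[R]_m => (t ord0 k, y k)) (fun z : R^o * E => z.1 *: z.2)).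
  have FF := nbhs_filter t.
  apply: (@cvg_pair _ _ _ _ (nbhs (t ord0 k : R^o)) (nbhs (y k))).
    exact: coord_continuous.
  exact: cvg_cst.
exact: scale_continuous.
Qed.

(** * The Kakutani-Fan-Glicksberg theorem in a product *)

Section FixedPoint.
Variables (R : realType) (I : eqType) (E : I -> tvsType R).
Variable X : forall i, set (E i).
Variable M : forall i, prod_topology E -> set (E i).
Arguments X : clear implicits.
Arguments M : clear implicits.
Hypothesis X_nonempty : forall i, X i !=set0.
Hypothesis X_compact : forall i, compact (X i).
Hypothesis X_convex : forall i, convex_set (X i).
Hypothesis M_nonempty : forall i x, prod_set X x -> M i x !=set0.
Hypothesis M_sub : forall i x, prod_set X x -> M i x `<=` X i.
Hypothesis M_convex : forall i x, prod_set X x -> convex_set (M i x).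
Hypothesis M_closed : forall i x z, prod_set X x -> X i z -> ~ M i x z ->
  \forall z' \near z & x' \near within (prod_set X) (nbhs x), ~ M i x' z'.

Let compact_prod_set : compact (prod_set X : set (prod_topology E)).
Proof. exact: tychonoff. Qed.

(** Closeness is asked only for nonzero weights, the ones that [simplex_cover] controls. *)
Definition approx_fixpoints (D : set (prod_topology E * prod_topology E)) :=
  [set x : prod_topology E | prod_set X x /\
    exists m (t : 'I_m -> R) (a y : 'I_m -> prod_topology E),
      [/\ forall k, 0 <= t k, \sum_k t k = 1,
          forall i, x i = \sum_k t k *: y k i,
          forall k, prod_set X (a k) /\ forall i, M i (a k) (y k i) &
          forall k, t k != 0 -> D (x, a k)]].

Lemma approx_fixpoints_nonempty (D : set (prod_topology E * prod_topology E)) :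
  entourage D -> approx_fixpoints D !=set0.
Proof.
(* Two half steps lead from [f t] to [a k]: to a nearby [f t'], by continuity of [f], then to [a k],
   by the inverse relation. *)
move=> eD; pose D' := split_ent D `&` (split_ent D)^-1%relation.
have eD' : entourage D' by apply: entourage_invI; exact: entourage_split_ent.
have [s [sX sD]] := @compact_totally_bounded (prod_topology E) _ _
  compact_prod_set eD'.
have [x0 Xx0] : prod_set X !=set0.
  by exists (fun i => sval (cid (X_nonempty i))) => i; case: cid.
have [a0 a0s _] := sD _ Xx0.
have m0 : (0 < size s)%N by case: (s) a0s.
pose m := size s; pose a (k : 'I_m) := tnth (in_tuple s) k.
have aX k : prod_set X (a k) by apply: sX; exact: mem_tnth.
have /choice[y yM] (k : 'I_m) :
    exists y : prod_topology E, forall i, M i (a k) (y i).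
  by exists (fun i => sval (cid (M_nonempty i (aX k)))) => i; case: cid.
pose f (t : 'rV[R]_m) : prod_topology E := fun i => \sum_k t ord0 k *: y k i.
have f_cts : continuous f.
  by move=> t; apply: (prod_cvg (nbhs_filter t)) => i; exact: continuous_comb.
have fX t : simplex t -> prod_set X (f t).
  case=> t0 t1 i; apply: convex_sum => // k _.
  by apply: (M_sub (aX k)).
have [t [t0 t1] tG] : exists2 t, @simplex R m t &
    forall k, t ord0 k != 0 ->
      closure (@simplex R m `&` [set t | D' (a k, f t)]) t.
  apply: (simplex_cover (Ordinal m0)) => t /fX/sD[b bs Db].
  have bm : (index b s < m)%N by rewrite index_mem.
  by exists (Ordinal bm); rewrite //= /a (tnth_nth b) /= nth_index.
exists (f t); split; first exact: fX.
exists m, (fun k => t ord0 k), a, y; split=> // k /tG clt.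
have : nbhs t (f @^-1` xsection D' (f t)) by apply: f_cts;
  exact: nbhs_entourage.
move=> /clt[t' [[_ [_ Dat]] /xsectionP[Dtt _]]].
exact: (entourage_split _ eD Dtt Dat).
Qed.

(** By the closed graph, each point of the compact set [X i] minus [Z] has a neighbourhood avoiding
    [M i x'] for [x'] near [x]; compactness makes this uniform. *)
Lemma usc_near (i : I) (x : prod_topology E) (Z : set (E i)) :
  prod_set X x -> open Z -> M i x `<=` Z ->
  \forall x' \near within (prod_set X) (nbhs x), M i x' `<=` Z.
Proof.
move=> Xx oZ MZ.
have cK : compact (X i `&` ~` Z) by apply: compact_closedI => //;
  exact: open_closedC.
move: cK => /compact_near_coveringP/(_ _ (within (prod_set X) (nbhs x))
  (fun x' z => ~ M i x' z) _) cov.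
have {}cov := cov (fun z '(conj Xz nZz) => M_closed Xx Xz
  (fun h => nZz (MZ _ h))).
have XX : within (prod_set X) (nbhs x) (prod_set X) by exact: withinT.
apply: filterS2 XX cov => x' Xx' h z Mz; apply: contrapT => nZ.
by apply: (h z) => //; split=> //; exact: (M_sub Xx').
Qed.

(** [Z] is [A + U] for a convex neighbourhood [U] of 0, chosen with [N] so that [N - U] misses
    [A]. *)
Lemma separate_convex (i : I) (A : set (E i)) (z : E i) : convex_set A ->
  nbhs z (~` A) ->
  exists2 N, nbhs z N & exists Z : set (E i),
    [/\ open Z, convex_set Z, A `<=` Z & N `&` Z = set0].
Proof.
move=> cA zA.
have := @sub_continuous (E i) (z, 0) (~` A); rewrite /= subr0 => /(_ zA).
case=> -[N B] /= [zN B0] NB.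
have [bs bs_convex [bs_open bs_basis]] := @locally_convex R (E i).
have [U [bU U0] UB] := bs_basis 0 B B0.
pose Z := \bigcup_(v in A) [set w | U (w - v)].
exists N => //; exists Z; split.
- apply: bigcup_open => v Av; apply: (@open_comp _ _ (fun w => w - v) U).
    move=> w _; apply: (@continuous_comp _ (E i * E i)%type _
      (fun w => (w, v)) (fun p => p.1 - p.2)); last exact: sub_continuous.
    by apply: cvg_pair; [exact: cvg_id|exact: cvg_cst].
  exact: bs_open.
- have /convex_setP cU : convex_set U by apply: bs_convex; exact: mem_set.
  apply/convex_setP => w w' l l0 l1 [v Av Uv] [v' Av' Uv'].
  exists (l *: v + (1 - l) *: v') => /=; first by move/convex_setP: cA; apply.
  by rewrite opprD addrACA -!scalerBr; exact: cU.
- by move=> v Av; exists v => //=; rewrite subrr.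
- rewrite -subset0 => w [Nw [v Av Uv]].
  by have := NB (w, w - v); rewrite /= subKr; apply=> //; split=> //; exact: UB.
Qed.

Theorem prod_fixpoint : exists x : prod_topology E,
  prod_set X x /\ forall i, M i x (x i).
Proof.
pose F := filter_from (@entourage (prod_topology E)) approx_fixpoints.
have FF : ProperFilter F.
  apply: filter_from_proper; last by move=> D /approx_fixpoints_nonempty.
  apply: filter_from_filter; first by exists setT; exact: entourageT.
  move=> D D' eD eD'; exists (D `&` D'); first exact: filterI.
  move=> x [Xx [m [t [a [y [t0 t1 xE aM xD]]]]]].
  by split; split=> //; exists m, t, a, y; split=> // k /xD[].
have FX : F (prod_set X) by exists setT => [|x []//]; exact: entourageT.
have [x [Xx clx]] := compact_prod_set FF FX.
exists x; split=> // i; apply: contrapT => nMx.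
have zM : nbhs (x i) (~` M i x).
  have [[B C] /= [xB xC] BC] := M_closed Xx (Xx i) nMx.
  apply: filterS xB => z Bz; apply: (BC (z, x)); split=> //=.
  by apply: (nbhs_singleton xC).
have [N xN [Z [oZ cZ MZ NZ]]] := separate_convex (M_convex (i := i) Xx) zM.
have := usc_near Xx oZ MZ; rewrite /within /= => /nbhsP[D eD DZ].
have FD : F (approx_fixpoints (split_ent D)) by exists (split_ent D);
  [exact: entourage_split_ent|].
have nx : nbhs x (xsection (split_ent D) x `&` (fun x' => N (x' i))).
  apply: filterI; first by apply: nbhs_entourage; exact: entourage_split_ent.
  exact: (@proj_continuous I E i x N xN).
have [x' [[_ [m [t [a [y [t0 t1 xE aM xD]]]]]] [/xsectionP Dx Nx]]]
  := clx _ _ FD nx.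
suff Zx : Z (x' i) by have : (N `&` Z) (x' i) by []; rewrite NZ.
rewrite xE; apply: convex_sum => // k /xD Dk.
(* Both [x'] and [a k] are within half of [D], so [a k] is in the region where [M i] has values
   inside [Z]. *)
have [Xa Ma] := aM k; apply: (DZ (a k)) => //.
by apply/xsectionP; exact: (entourage_split _ eD Dx Dk).
Qed.

End FixedPoint.

(** * Hypotheses in neighbourhood form, and the equilibrium theorem *)

Lemma dfwith_near (I : eqType) (K : I -> topologicalType) (i : I)
    (x : prod_topology K) (z : K i) (W : set (prod_topology K)) :
  nbhs (dfwith x i z : prod_topology K) W ->
  exists A B, [/\ nbhs x A, nbhs z B &
    forall x' z', A x' -> B z' -> W (dfwith x' i z')].
Proof.
move=> /(@dfwith_cvg I K i x z)[[A B] [xA zB] AB]; exists A, B; split=> //.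
by move=> x' z' Ax Bz; exact: (AB (x', z')).
Qed.

Lemma dfwith_id (I : eqType) (T : I -> Type) (x : forall i, T i) (i : I) :
  dfwith x i (x i) = x.
Proof. by apply: functional_extensionality_dep => j; case: dfwithP. Qed.

(** For an open [G] around [y], lower semicontinuity applied to [B] minus [G] makes the points whose
    values avoid [G] a relatively closed set, which misses [x]. *)
Lemma lsc_near (U V : topologicalType) (D : set U) (B : set V) (T : U -> set V)
    (x : U) (y : V) (W : set V) :
  (forall x', D x' -> T x' `<=` B) -> set_valued_lsc D B T ->
  D x -> T x y -> nbhs y W ->
  \forall x' \near within D (nbhs x), exists2 y', T x' y' & W y'.
Proof.
move=> TB lsc Dx Txy; rewrite nbhsE => -[G [oG Gy] GW].
have cB : closed (B `&` ~` G : set (subspace B)).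
  apply/closed_subspaceP; exists (~` G); first exact: open_closedC.
  by rewrite [B `&` _]setIC -setIA setIid.
have /closed_subspaceP[C cC CE] := lsc _ (@subIsetl _ B (~` G)) cB.
have nCx : (~` C) x.
  move=> Cx; have : (C `&` D) x by [].
  by rewrite CE => -[[_ /(_ _ Txy)[_]]].
have : nbhs x (~` C) by apply: open_nbhs_nbhs; split=> //; exact: closed_openC.
rewrite /within /=; apply: filterS => x' nC Dx'.
apply: contrapT => h; apply: nC; suff : (C `&` D) x' by case.
rewrite CE; split=> //; split=> // y' Ty'; split; first exact: (TB _ Dx').
by move=> Gy'; apply: h; exists y' => //; exact: GW.
Qed.

(** The neighbourhoods of [x0], ordered by reverse inclusion, index a net of chosen points
    converging to [x0]. *)
Lemma net_closed (T : topologicalType) (D : set T) (P : T -> Prop) :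
  (forall (A : Type) (le : A -> A -> Prop) (x : A -> T) (x0 : T), directed le ->
    (forall a, D (x a)) -> D x0 -> x @ tails le --> x0 ->
    (forall a, P (x a)) -> P x0) ->
  forall x0, D x0 -> closure [set x | D x /\ P x] x0 -> P x0.
Proof.
move=> netP x0 Dx0 clx0.
pose A := {O : set T | nbhs x0 O}.
pose le (O O' : A) := sval O' `<=` sval O.
have /choice[x xP] (O : A) : exists x, sval O x /\ (D x /\ P x).
  by have [x [? ?]] := clx0 _ (svalP O); exists x.
apply: (netP A le x) => //.
- split.
  + by constructor; exists setT; exact: filterT.
  + by move=> O.
  + by move=> O1 O2 O3 h12 h23 y /h23 /h12.
  + move=> O O'; exists (exist _ _ (filterI (svalP O) (svalP O'))).
    by split=> y [].
- by move=> O; have [_ []] := xP O.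
- move=> W xW; exists (exist _ W xW) => O OW; apply: OW.
  by have [] := xP O.
- by move=> O; have [_ []] := xP O.
Qed.

Unset Implicit Arguments.

(* [dfwith x i z] is the point (x_1, ..., z, ..., x_n) with z in position i. *)
Theorem corollary2 (R : realType) (n : nat) (E : 'I_n -> tvsType R)
    (X : forall i : 'I_n, set (E i))
    (S Q : forall i : 'I_n, prod_topology E -> set (E i))
    (phi : 'I_n -> prod_topology E -> R)
    (E_hausdorff : forall i, hausdorff_space (E i))
    (X_nonempty : forall i, X i !=set0)
    (X_compact : forall i, compact (X i))
    (X_convex : forall i, convex_set (X i))
    (S_values : forall i x, prod_set X x -> S i x !=set0 /\ S i x `<=` X i)
    (Q_values : forall i x, prod_set X x -> Q i x !=set0 /\ Q i x `<=` X i)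
    (H2 : forall i (x : prod_topology E),
      (forall j, j != i -> X j (x j)) ->
      convex_set [set z | X i z /\ S i (dfwith x i z) z])
    (H4 : forall i (A : Type) (le : A -> A -> Prop)
        (x : A -> prod_topology E) (x0 : prod_topology E),
      directed le ->
      (forall a, prod_set X (x a)) -> prod_set X x0 ->
      x @ tails le --> x0 ->
      (forall a, S i (x a) (x a i)) -> S i x0 (x0 i))
    (Ha : forall i (x : prod_topology E),
      (forall j, j != i -> X j (x j)) ->
      exists z : E i, [/\ X i z, S i (dfwith x i z) z &
        forall y, Q i (dfwith x i z) y ->
          phi i (dfwith x i z) <= phi i (dfwith x i y)])
    (Hb_quasiconvex : forall i (x : prod_topology E),
      (forall j, j != i -> X j (x j)) ->
      quasiconvex_on (X i) (fun z => phi i (dfwith x i z)))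
    (Hb_independent : forall i (x y : prod_topology E),
      prod_set X x -> prod_set X y -> (forall j, j != i -> x j = y j) ->
      Q i x = Q i y)
    (Hc_continuous : forall i, {within prod_set X, continuous (phi i)})
    (Hc_lsc : forall i, set_valued_lsc (prod_set X) (X i) (Q i)) :
  exists x : prod_topology E, prod_set X x /\
    forall i, S i x (x i) /\
      forall y, Q i x y -> phi i x <= phi i (dfwith x i y).
Proof.
(* The competitors are taken in [Q i x], equal to [Q i (dfwith x i z)] by (b), so they are the same
   for all [z]; this gives convexity. *)
pose M i (x : prod_topology E) := [set z | [/\ X i z, S i (dfwith x i z) z &
  forall y, Q i x y -> phi i (dfwith x i z) <= phi i (dfwith x i y)]].
have dfX i x z : prod_set X x -> X i z -> prod_set X (dfwith x i z).
  by move=> Xx Xz j; case: dfwithP.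
have [x [Xx Mx]] : exists x : prod_topology E, prod_set X x /\ forall i, M i x
  (x i).
  apply: prod_fixpoint => //.
  - move=> i x Xx; have [z [Xz Sz Qz]] := Ha i x (fun j _ => Xx j).
    exists z; split=> // y Qy; apply: Qz.
    rewrite (Hb_independent i _ x) //; first exact: dfX.
    by move=> j ji; rewrite dfwithout // eq_sym.
  - by move=> i x Xx z [].
  - move=> i x Xx z z' l /set_mem[Xz Sz Qz] /set_mem[Xz' Sz' Qz'].
    have Xxi j : j != i -> X j (x j) by move=> _; exact: Xx.
    apply/mem_set.
    have /set_mem[Xl Sl] := H2 i x Xxi z z' l (mem_set (conj Xz Sz)) (mem_set
      (conj Xz' Sz')).
    split=> // y Qy; apply: le_trans (Hb_quasiconvex i x Xxi l z z' Xz Xz') _.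
    by rewrite ge_max Qz // Qz'.
  - move=> i x z Xx Xz nM.
    have [Sz|nSz] := pselect (S i (dfwith x i z) z); last first.
      (* By (H4) for nets, a point of [prod_set X] where the constraint fails has a neighbourhood
         where it fails throughout [prod_set X]. *)
      have : nbhs (dfwith x i z : prod_topology E) (~` [set w |
        prod_set X w /\ S i w (w i)]).
        apply: contrapT => h; apply: nSz; rewrite -[z in S _ _ z](dfwithin x).
        apply: (net_closed (H4 i)) => [|B wB]; first exact: dfX.
        apply: contrapT => hB; apply: h; apply: filterS wB => w Bw wS.
        by apply: hB; exists w.
      case/dfwith_near => A [B [xA zB AB]].
      exists (B, A `&` prod_set X).
        by split=> //=; apply: filterI; [exact: cvg_within|exact: withinT].
      case=> z' x' /= [Bz' [Ax' Xx']] [Xz' Sz' _].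
      by apply: (AB x' z') => //; split; [exact: dfX|rewrite dfwithin].
    have [y Qy yz] : exists2 y, Q i x y & phi i (dfwith x i y) < phi i (dfwith
      x i z).
      apply: contrapT => h; apply: nM; split=> // y Qy; rewrite leNgt;
        apply/negP => yz.
      by apply: h; exists y.
    have Xy : X i y by exact: (Q_values i x Xx).2.
    (* The midpoint [r] separates the two values: near [(x, z)] the function stays above [r], near
       [(x, y)] below it, and [lsc_near] supplies a competitor [y'] close to [y]. *)
    pose r := (phi i (dfwith x i y) + phi i (dfwith x i z)) / 2.
    have [yr rz] := midf_lt yz; rewrite -/r in yr rz.
    have phi_cts := (subspace_continuousP _ (phi i)).1 (Hc_continuous i).
    have nz : nbhs (phi i (dfwith x i z)) [set u | r < u].
      by apply: open_nbhs_nbhs; split=> //; exact: open_gt.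
    have ny : nbhs (phi i (dfwith x i y)) [set u | u < r].
      by apply: open_nbhs_nbhs; split=> //; exact: open_lt.
    have [A [B [xA zB AB]]] := dfwith_near (phi_cts _ (dfX i x z Xx Xz) _ nz).
    have [A' [B' [xA' yB' AB']]] := dfwith_near (phi_cts _ (dfX i x y Xx Xy) _
      ny).
    have QX x' : prod_set X x' -> Q i x' `<=` X i by move=> /(Q_values i)[].
    have xQ := lsc_near QX (Hc_lsc i) Xx Qy yB'.
    exists (B, A `&` A' `&` [set x' |
      exists2 y', Q i x' y' & B' y'] `&` prod_set X).
      split=> //=; apply: filterI; last exact: withinT.
      by do 2?[apply: filterI => //]; exact: cvg_within.
    case=> z' x' /= [Bz' [[[Ax' A'x'] [y' Qy' By']] Xx']] [Xz' Sz' /(_ _ Qy')].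
    rewrite leNgt => /negP; apply.
    have Xy' := QX _ Xx' _ Qy'.
    have := AB _ _ Ax' Bz' (dfX i x' z' Xx' Xz').
    have := AB' _ _ A'x' By' (dfX i x' y' Xx' Xy').
    exact: lt_trans.
exists x; split=> // i; have [_ Sx Qx] := Mx i.
by rewrite dfwith_id in Sx Qx.
Qed.
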